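(* $\mathcal{L}(n)$ is a graded lattice of rank $2^n-n-2$; i.e. this is the length of all maximal chains of $\mathcal{L}(n)$.
   Context: A finite atomic lattice is a finite lattice (with minimum $\hat 0$ and maximum $\hat 1$) in which every element other than $\hat 0$ is a join of atoms, an atom being an element covering $\hat 0$. $\mathcal{L}(n)$ is the set of all finite atomic lattices with $n$ ordered atoms (up to isomorphism respecting the ordering of the atoms), partially ordered by: $Q\leq P$ if and only if there is a join-preserving map $P\to Q$ which is a bijection on atoms (respecting the ordering). Equivalently, a finite atomic lattice with $n$ ordered atoms is identified with a set $\mathcal{S}$ of subsets of $\{1,\dots,n\}$ that is closed under intersections and contains $\emptyset$, $\{1,\dots,n\}$ and all singletons $\{i\}$ (ordered by inclusion), and $Q\le P$ if and only if $\mathcal{S}_Q\subseteq\mathcal{S}_P$, where $\mathcal{S}_P$ denotes the set of subsets identified with $P$. The length of a chain is its number of elements minus one. *)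

(* Defs.v *)
From mathcomp Require Import all_boot all_order.

Set Implicit Arguments.
Unset Strict Implicit.
Unset Printing Implicit Defensive.

Import Order.TTheory.
Local Open Scope order_scope.

(** * Graded lattices, for a relation on an arbitrary type *)

Section Graded.
Context {T : Type}.
Implicit Types (le : T -> T -> Prop) (C : T -> Prop).

Definition is_partial_order le : Prop :=
  [/\ forall x, le x x,
      forall x y, le x y -> le y x -> x = y
    & forall x y z, le x y -> le y z -> le x z].

Definition is_lub le (x y z : T) : Prop :=
  [/\ le x z, le y z & forall u, le x u -> le y u -> le z u].

Definition is_glb le (x y z : T) : Prop :=
  [/\ le z x, le z y & forall u, le u x -> le u y -> le u z].

Definition is_lattice le : Prop :=
  is_partial_order le /\
  forall x y, (exists z, is_lub le x y z) /\ (exists z, is_glb le x y z).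

Definition is_chain le C : Prop :=
  forall x y, C x -> C y -> le x y \/ le y x.

Definition is_maximal_chain le C : Prop :=
  is_chain le C /\
  forall D : T -> Prop, is_chain le D -> (forall x, C x -> D x) ->
    forall x, D x -> C x.

Definition has_card C (m : nat) : Prop :=
  exists2 f : 'I_m -> T, injective f & forall x, C x <-> exists i, x = f i.

(* The length of a chain is its number of elements minus one. *)
Definition has_length C (r : nat) : Prop := has_card C r.+1.

Definition is_graded_lattice_of_rank le (r : nat) : Prop :=
  is_lattice le /\ forall C, is_maximal_chain le C -> has_length C r.

End Graded.

(** * Finite atomic lattices with n ordered atoms *)

Definition is_atom d (T : finTBLatticeType d) (a : T) : Prop :=
  \bot < a /\ forall x : T, ~~ (\bot < x < a).

Definition is_atomic d (T : finTBLatticeType d) : Prop :=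
  forall x : T, x != \bot ->
    exists A : {set T}, (forall a, a \in A -> is_atom a) /\ x = \join_(a in A) a.

Record atomicLattice (n : nat) := AtomicLattice {
  al_disp : Order.disp_t;
  al_sort :> finTBLatticeType al_disp;
  al_atomic : is_atomic al_sort;
  (* the ordered list of atoms, without repetition *)
  atom : 'I_n -> al_sort;
  atom_inj : injective atom;
  atomP : forall x : al_sort, is_atom x <-> exists i, x = atom i
}.

Definition al_iso n (P Q : atomicLattice n) : Prop :=
  exists f : P -> Q,
    [/\ bijective f, {mono f : x y / x <= y} & forall i, f (atom P i) = atom Q i].

Definition al_le n (Q P : atomicLattice n) : Prop :=
  exists f : P -> Q,
    Order.join_morphism f /\ forall i, f (atom P i) = atom Q i.

(** * The poset L(n) of isomorphism classes *)

(* Isomorphism classes are plain Prop-valued predicates: a MathComp quotient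
   would need an eqType on [atomicLattice n], which lives in a universe above
   the carriers of MathComp structures. *)
Definition calL (n : nat) : Type :=
  {C : atomicLattice n -> Prop | exists P, C = al_iso P}.

Definition calL_le n (X Y : calL n) : Prop :=
  exists Q P, [/\ sval X Q, sval Y P & al_le Q P].

(* Main.v *)
From HB Require Import structures.
From mathcomp Require Import boolp.
Require Import Defs.
From mathcomp Require Import all_boot all_order.

Set Implicit Arguments.
Unset Strict Implicit.
Unset Printing Implicit Defensive.

Import Order.TTheory.

(** In a finite atomic lattice [P] with [n] ordered atoms an element is
    determined by the set of atoms below it, and these sets form a closure
    system on ['I_n]: a family of subsets closed under intersection that
    contains the empty set, the whole set and all singletons.  Conversely,
    every closure system, ordered by inclusion, is such a lattice
    ([realization]).  Under this correspondence isomorphism becomes equality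
    ([al_isoP]) and the order of L(n) becomes inclusion of families
    ([al_leP]), so that L(n) is the poset of closure systems on ['I_n].

    Meets in this poset are intersections.  The join of [S] and [S'] consists
    of all [A :&: B] with [A] in [S] and [B] in [S'].

    Gradedness rests on one observation, [closure_system_remove]: if [S] is a
    proper subfamily of [S'], then a set [X] of largest cardinality in
    [S' :\: S] can be dropped from [S'].  For if [X] were the intersection of
    two members of [S'] other than [X], these would be strictly larger than
    [X], hence in [S], and so would be [X].  Consequently, between two
    comparable closure systems there is always one with exactly one member
    fewer than the larger one, and a maximal chain takes every cardinality
    between that of the least system, consisting of the sets that are always
    present ([n + 2] of them for [n >= 2]), and that of the greatest,
    consisting of all [2 ^ n] subsets ([maximal_chain_length]). *)

(** * Maximal chains in the presence of a rank function *)

(** A maximal chain [C] contains [b] and [t].  If [x] in [C] is not [b], let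
    [y] be the element of [C] just below [x]; an element [z] of rank one less
    than [x] between [y] and [x] is comparable with all of [C], so it lies in
    [C].  Descending from [t], the chain meets every rank down to that of [b],
    and it meets each of them once because [rho] is strictly increasing. *)
Lemma maximal_chain_length T (le : T -> T -> Prop) (rho : T -> nat) (b t : T) :
    is_partial_order le ->
    (forall x, le b x) -> (forall x, le x t) ->
    (forall x y, le x y -> x <> y -> rho x < rho y) ->
    (forall x y, le x y -> x <> y ->
       exists z, [/\ le x z, le z y & rho y = (rho z).+1]) ->
  forall C, is_maximal_chain le C -> has_length C (rho t - rho b).
Proof.
move=> [lexx _ le_tr] leb let_ rho_lt cover C [chC maxC].
(* Adjoining to [C] an element comparable with all of [C] keeps it a chain. *)
have CE z : (forall x, C x -> le x z \/ le z x) -> C z.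
  move=> cmp; apply: (maxC (fun x => C x \/ x = z)); [|by left|by right].
  move=> x y [Cx|->] [Cy|->]; first exact: chC.
  - exact: cmp.
  - by case: (cmp y Cy); [right|left].
  - by left.
have rho_le x y : le x y -> rho x <= rho y.
  by move=> xy; case: (EM (x = y)) => [->//|nxy]; apply/ltnW/rho_lt.
have leC x y : C x -> C y -> rho x <= rho y -> le x y.
  move=> Cx Cy xy; case: (chC _ _ Cx Cy) => // yx.
  case: (EM (y = x)) => [->//|/(rho_lt _ _ yx)]; by rewrite ltnNge xy.
have Cinj x y : C x -> C y -> rho x = rho y -> x = y.
  move=> Cx Cy exy; case: (EM (x = y)) => // nxy.
  have xy: le x y by apply: leC; rewrite // exy.
  by have := rho_lt _ _ xy nxy; rewrite exy ltnn.
have Cb : C b by apply: CE => x _; right.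
have Ct : C t by apply: CE => x _; left.
have level k : k <= rho t - rho b -> exists2 x, C x & rho x = rho t - k.
  elim: k => [|k IH] ltk; first by exists t; rewrite ?subn0.
  have [x Cx rx] := IH (ltnW ltk).
  have bx : rho b < rho x.
    by rewrite rx ltn_subRL addnC -ltn_subRL.
  (* [y] is an element of [C] of largest rank among those of rank below [x]. *)
  pose p m := `[< exists y, [/\ C y, rho y = m & m < rho x] >].
  have exp : exists m, p m by exists (rho b); apply/asboolP; exists b.
  have ubp m : p m -> m <= rho x by move=> /asboolP[y [_ _ /ltnW]].
  case: (ex_maxnP exp ubp) => _ /asboolP[y [Cy <- yx]] ymax.
  have [||z [yz zx rz]] := cover y x; first exact/leC/ltnW.
    by move=> exy; rewrite exy ltnn in yx.
  exists z; last by rewrite subnS -rx rz.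
  apply: CE => w Cw; case: (ltnP (rho w) (rho x)) => [wx|xw].
    left; apply: (le_tr _ y) => //; apply: leC => //.
    by apply: ymax; apply/asboolP; exists w.
  by right; apply: (le_tr _ x) => //; apply: leC.
have le_bt : rho b <= rho t by apply: rho_le.
have /choice[f fP] : forall i : 'I_(rho t - rho b).+1,
    exists x, C x /\ rho x = rho b + i.
  move=> i; have [x Cx rx] := level _ (leq_subr i (rho t - rho b)).
  exists x; split=> //; rewrite rx -{1}(subnKC le_bt) -addnBA ?leq_subr //.
  by rewrite subKn // -ltnS.
exists f => [i j fij|x].
  by apply/val_inj/(@addnI (rho b)); have [_ <-] := fP i; have [_ <-] := fP j; rewrite fij.
split=> [Cx|[i ->]]; last by case: (fP i).
have lti : rho x - rho b < (rho t - rho b).+1 by rewrite ltnS leq_sub2r ?rho_le.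
exists (Ordinal lti); have [Cf rf] := fP (Ordinal lti).
by apply: Cinj; rewrite // rf /= subnKC ?rho_le.
Qed.

(** * Atomic lattices as families of sets of atoms *)

Section AtomicLatticeAsFamily.
Variable n : nat.
Local Open Scope order_scope.
Implicit Types (P Q : atomicLattice n).

Definition atoms_below P (x : P) : {set 'I_n} := [set i | atom P i <= x].

Definition family P : {set {set 'I_n}} := [set atoms_below x | x : P].

Lemma atoms_belowP P (x : P) i : (i \in atoms_below x) = (atom P i <= x).
Proof. by rewrite inE. Qed.

Lemma mem_family P (x : P) : atoms_below x \in family P.
Proof. exact: imset_f. Qed.

(** Atomicity enters here: every element is the join of the atoms below it,
    so that a lattice is recovered from its sets of atoms. *)
Lemma le_atoms_below P (x y : P) :
  (x <= y) = (atoms_below x \subset atoms_below y).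
Proof.
apply/idP/subsetP => [xy i|sub].
  by rewrite !atoms_belowP => /le_trans; apply.
have [->|x0] := eqVneq x \bot; first exact: le0x.
have [A [atA xE]] := al_atomic x0.
rewrite xE; apply/joinsP => a aA; have [i aE] := (atomP a).1 (atA _ aA).
rewrite aE -atoms_belowP sub // atoms_belowP -aE xE; exact: joins_sup.
Qed.

Lemma atoms_below_inj P : injective (@atoms_below P).
Proof.
by move=> x y exy; apply/le_anti; rewrite !le_atoms_below exy subxx.
Qed.

Lemma atoms_belowI P (x y : P) :
  atoms_below (x `&` y) = atoms_below x :&: atoms_below y.
Proof. by apply/setP => i; rewrite in_setI !atoms_belowP lexI. Qed.

Lemma atoms_below_top P : @atoms_below P \top = setT.
Proof. by apply/setP => i; rewrite atoms_belowP lex1 inE. Qed.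

Lemma atoms_below_bot P : @atoms_below P \bot = set0.
Proof.
apply/setP => i; rewrite atoms_belowP inE.
by have [/lt_geF] := (atomP (atom P i)).2 (ex_intro _ i erefl).
Qed.

Lemma atoms_below_atom P i : atoms_below (atom P i) = [set i].
Proof.
apply/setP => j; rewrite atoms_belowP inE.
have [_ minp] := (atomP (atom P i)).2 (ex_intro _ i erefl).
have [jb _] := (atomP (atom P j)).2 (ex_intro _ j erefl).
have := minp (atom P j); rewrite jb /= -(inj_eq (@atom_inj _ P)).
by rewrite le_eqVlt => /negPf->; rewrite orbF.
Qed.

Definition join_atoms P (A : {set 'I_n}) : P := \join_(i in A) atom P i.

Lemma join_atoms_le P A (x : P) :
  (join_atoms P A <= x) = (A \subset atoms_below x).
Proof.
apply/joinsP/subsetP => sub i iA.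
  by rewrite atoms_belowP sub.
by rewrite -atoms_belowP sub.
Qed.

Lemma join_atomsK P A : A \in family P -> atoms_below (join_atoms P A) = A.
Proof.
move=> /imsetP[x _ ->]; congr atoms_below.
by apply/le_anti; rewrite join_atoms_le subxx le_atoms_below -join_atoms_le lexx.
Qed.

Lemma atoms_belowK P (x : P) : join_atoms P (atoms_below x) = x.
Proof. exact/atoms_below_inj/join_atomsK/mem_family. Qed.

(** Given a join-preserving [f : P -> Q] and [q : Q] with an atom below it, let
    [p] be the join in [P] of the corresponding atoms; then [f p <= q], so that
    [p] has no further atoms below it and the set of atoms of [q] occurs in
    [P].  The empty set of atoms occurs as that of [\bot].
    Conversely, if every atom set of [Q] occurs in [P], then sending [x] to
    the join in [Q] of the atoms below it preserves joins: the atom set of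
    [f x `|` f y] is that of some [p : P], and [p] is above [x] and [y]. *)
Lemma al_leP Q P : al_le Q P <-> family Q \subset family P.
Proof.
split=> [[f [fU fa]]|sub].
  apply/subsetP => _ /imsetP[q _ ->].
  have f_mono : {homo f : x y / x <= y}.
    by move=> x y; rewrite !leEjoin -fU => /eqP->.
  apply/imsetP; exists (join_atoms P (atoms_below q)) => //.
  have [q0|[i iq]] := set_0Vmem (atoms_below q).
    by rewrite q0 /join_atoms big_set0 atoms_below_bot.
  apply/eqP; rewrite eqEsubset -join_atoms_le lexx /=.
  (* For [n = 1], [f] may move [\bot] to the atom; joining with a fixed atom
     below [q] keeps [f \bot] out of the induction on the join. *)
  have fle : f (atom P i `|` join_atoms P (atoms_below q)) <= q.
    rewrite /join_atoms.
    apply: (big_ind (fun x => f (atom P i `|` x) <= q)).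
    - by rewrite joinx0 fa -atoms_belowP.
    - by move=> x y fx fy; rewrite -[atom P i]joinxx joinACA fU leUx fx.
    - by move=> j jq; rewrite fU !fa leUx -!atoms_belowP iq.
  apply/subsetP => j; rewrite !atoms_belowP -fa => /f_mono/le_trans; apply.
  by apply: le_trans fle; apply: f_mono; exact: leUr.
exists (fun x => join_atoms Q (atoms_below x)); split=> [x y|i] /=; last first.
  by rewrite atoms_below_atom /join_atoms big_set1.
apply/le_anti/andP; split; last first.
  have up (A : {set 'I_n}) : A \subset atoms_below (join_atoms Q A) by rewrite -join_atoms_le.
  by rewrite leUx !join_atoms_le; apply/andP; split; apply: subset_trans (up _);
     rewrite -le_atoms_below ?leUl ?leUr.
rewrite join_atoms_le; set q : Q := _ `|` _.
have /imsetP[p _ qp] := subsetP sub _ (mem_family q).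
rewrite qp -le_atoms_below leUx !le_atoms_below -qp -!join_atoms_le.
by rewrite leUl leUr.
Qed.

(** An isomorphism does not change the set of atoms below an element;
    conversely, matching the elements with equal atom sets is one. *)
Lemma al_isoP P Q : al_iso P Q <-> family P = family Q.
Proof.
split=> [[f [[g fK gK] fm fa]]|PQ].
  have fA x : atoms_below (f x) = atoms_below x.
    by apply/setP => i; rewrite !atoms_belowP -fa fm.
  apply/setP => A; apply/imsetP/imsetP => [[x _ ->]|[y _ ->]].
    by exists (f x).
  by exists (g y); rewrite // -fA gK.
exists (fun x => join_atoms Q (atoms_below x)); split.
- exists (fun y => join_atoms P (atoms_below y)) => x; last first.
  + by rewrite join_atomsK ?atoms_belowK // PQ mem_family.
  + by rewrite join_atomsK ?atoms_belowK // -PQ mem_family.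
- by move=> x y; rewrite join_atoms_le join_atomsK -?PQ ?mem_family // le_atoms_below.
- by move=> i; rewrite atoms_below_atom /join_atoms big_set1.
Qed.

End AtomicLatticeAsFamily.

(** * Closure systems *)

Section ClosureSystems.
Variable n : nat.
Implicit Types (S : {set {set 'I_n}}).

Definition trivial_sets : {set {set 'I_n}} :=
  set0 |: (setT |: [set [set i] | i : 'I_n]).

Definition closure_system S : Prop :=
  trivial_sets \subset S /\ {in S &, forall A B, A :&: B \in S}.

Lemma family_closure_system (P : atomicLattice n) : closure_system (family P).
Proof.
split=> [|_ _ /imsetP[x _ ->] /imsetP[y _ ->]]; last first.
  by rewrite -atoms_belowI mem_family.
rewrite !subUset !sub1set -(atoms_below_bot P) -(atoms_below_top P) !mem_family.
by apply/subsetP => _ /imsetP[i _ ->]; rewrite -(atoms_below_atom P) mem_family.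
Qed.

Lemma trivial_closure_system : closure_system trivial_sets.
Proof.
split=> // A B; rewrite !inE.
case/or3P => [/eqP->|/eqP->|/imsetP[i _ ->]]; first by rewrite set0I eqxx.
  by rewrite setTI.
move=> _; have [iB|iB] := boolP (i \in B).
  by rewrite (setIidPl _) ?sub1set // imset_f ?orbT.
suff -> : [set i] :&: B = set0 by rewrite eqxx.
by apply/eqP; rewrite setI_eq0 disjoints1.
Qed.

Lemma full_closure_system : closure_system setT.
Proof. by split=> [|A B]; rewrite ?subsetT ?inE. Qed.

Lemma closure_systemI S S' :
  closure_system S -> closure_system S' -> closure_system (S :&: S').
Proof.
move=> [tS iS] [tS' iS']; split; first by rewrite subsetI tS.
by move=> A B /setIP[AS AS'] /setIP[BS BS']; rewrite inE iS ?iS'.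
Qed.

Definition meets S S' : {set {set 'I_n}} := [set A :&: B | A in S, B in S'].

(** Both families are included because each contains the whole set; closure
    under intersection comes from exchanging the factors in
    [(A :&: B) :&: (A' :&: B')]. *)
Lemma meets_closure_system S S' :
  closure_system S -> closure_system S' ->
  [/\ closure_system (meets S S'), S \subset meets S S' & S' \subset meets S S'].
Proof.
move=> [tS iS] [tS' iS'].
have TS : setT \in S by apply: (subsetP tS); rewrite !inE eqxx orbT.
have TS' : setT \in S' by apply: (subsetP tS'); rewrite !inE eqxx orbT.
have sS : S \subset meets S S'.
  by apply/subsetP => A AS; rewrite -[A]setIT; apply: imset2_f.
have sS' : S' \subset meets S S'.
  by apply/subsetP => A AS; rewrite -[A]setTI; apply: imset2_f.
split=> //; split=> [|_ _ /imset2P[A B AS BS ->] /imset2P[A' B' AS' BS' ->]].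
  exact: subset_trans sS.
by rewrite setIACA; apply: imset2_f; [apply: iS|apply: iS'].
Qed.

(** The set removed is one of largest cardinality in [S' :\: S]: all members
    of [S'] strictly above it are in [S], and [S] is closed under
    intersection, so it is not an intersection of other members of [S']. *)
Lemma closure_system_remove S S' :
    closure_system S -> closure_system S' -> S \proper S' ->
  exists2 X, X \in S' & S \subset S' :\ X /\ closure_system (S' :\ X).
Proof.
move=> [tS iS] [tS' iS'] /properP[sub [X0 X0S' X0S]].
have X0D : X0 \in S' :\: S by rewrite inE X0S.
have [X /setDP[XS' XS] maxX] := @arg_maxnP _ X0 (mem (S' :\: S)) (fun A => #|A|) X0D.
have sSX : S \subset S' :\ X by rewrite subsetD1 sub.
exists X => //; do 2?split=> //; first exact: subset_trans sSX.
move=> A B /setD1P[AX AS'] /setD1P[BX BS']; rewrite in_setD1 iS' // andbT.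
apply: contra XS => /eqP XE.
have up Y : Y \in S' -> Y != X -> X \subset Y -> Y \in S.
  move=> YS' YX XY; apply: contraR YX => YS.
  by rewrite eq_sym eqEcard XY /=; apply: maxX; apply/setDP.
by rewrite -XE iS // up // -XE ?subsetIl ?subsetIr.
Qed.

(** For [n >= 2] there are [n + 2] distinct trivial sets; for [n <= 1] they
    exhaust the subsets of ['I_n], and both sides are truncated to [0]. *)
Lemma card_trivial_sets : 2 ^ n - #|trivial_sets| = 2 ^ n - n - 2.
Proof.
have cn : #|[set [set i] | i : 'I_n]| = n.
  by rewrite card_imset ?card_ord //; apply: set1_inj.
case: (ltnP 1 n) => [n1|n1].
  rewrite !cardsU1 cn !inE.
  have cT : #|[set: 'I_n]| = n by rewrite cardsT card_ord.
  have -> : (set0 == [set: 'I_n]) = false.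
    by apply/negP => /eqP e; move: cT n1; rewrite -e cards0 => <-.
  have -> : (set0 \in [set [set i] | i : 'I_n]) = false.
    by apply/negP => /imsetP[i _ /setP/(_ i)]; rewrite !inE eqxx.
  have -> : (setT \in [set [set i] | i : 'I_n]) = false.
    by apply/negP => /imsetP[i _ e]; move: cT n1; rewrite e cards1 => <-.
  by rewrite /= addnA addnC subnDA.
have -> : trivial_sets = setT.
  apply/setP => A; rewrite !inE.
  have := max_card A; rewrite card_ord => cA.
  have : #|A| <= 1 by apply: leq_trans n1.
  rewrite leq_eqVlt ltnS leqn0 cards_eq0 => /orP[/cards1P[i ->]|->//].
  by rewrite imset_f ?orbT.
rewrite -powersetT card_powerset cardsT card_ord subnn.
by case: n n1 => [|[|[]]].
Qed.

End ClosureSystems.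

(** * The atomic lattice of a closure system *)

Section Realization.
Variable n : nat.

(** Bundling the closure proof with the family lets the order structures be
    attached to the type of its members. *)
Record moore := Moore {
  moore_sets : {set {set 'I_n}};
  mooreP : closure_system moore_sets
}.

Variable S : moore.

Record closed_set := ClosedSet {
  closed_val : {set 'I_n};
  closed_valP : closed_val \in moore_sets S
}.

HB.instance Definition _ := [isSub for closed_val].
HB.instance Definition _ := [Finite of closed_set by <:].

Implicit Types (x y z : closed_set).

Lemma trivial_closed (A : {set 'I_n}) : A \in trivial_sets n -> A \in moore_sets S.
Proof. by case: (mooreP S) => [/subsetP sub _] /sub. Qed.

Definition closed_le x y := val x \subset val y.

Lemma closed_le_refl : reflexive closed_le.
Proof. by move=> x; apply: subxx. Qed.

Lemma closed_le_anti : antisymmetric closed_le.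
Proof. by move=> x y; rewrite /closed_le -eqEsubset => /eqP/val_inj. Qed.

Lemma closed_le_trans : transitive closed_le.
Proof. by move=> y x z; apply: subset_trans. Qed.

HB.instance Definition _ := Order.Le_isPOrder.Build (Order.Disp tt tt) closed_set
  closed_le_refl closed_le_anti closed_le_trans.

Lemma closed_meet_subproof x y : val x :&: val y \in moore_sets S.
Proof. by have [_ iS] := mooreP S; apply: iS; apply: valP. Qed.

Definition closed_meet x y : closed_set := ClosedSet (closed_meet_subproof x y).

Lemma closed_top_subproof : setT \in moore_sets S.
Proof. by apply: trivial_closed; rewrite !inE eqxx orbT. Qed.

Definition closed_top : closed_set := ClosedSet closed_top_subproof.

(** The closure of the union of [x] and [y], as the meet of their upper
    bounds. *)
Definition closed_join x y : closed_set :=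
  \big[closed_meet/closed_top]_(z | closed_le x z && closed_le y z) z.

Lemma closed_meetP x y z :
  closed_le x (closed_meet y z) = closed_le x y && closed_le x z.
Proof. by rewrite /closed_le subsetI. Qed.

Lemma closed_joinP x y z :
  closed_le (closed_join x y) z = closed_le x z && closed_le y z.
Proof.
have vE : val (closed_join x y)
    = \bigcap_(t | closed_le x t && closed_le y t) val t.
  exact: (big_morph val).
apply/idP/idP => [le_z|up]; last by rewrite /closed_le vE bigcap_inf.
by apply/andP; split; apply: (closed_le_trans _ le_z); rewrite /closed_le vE;
   apply/bigcapsP => t /andP[].
Qed.

HB.instance Definition _ :=
  Order.POrder_MeetJoin_isLattice.Build (Order.Disp tt tt) closed_set
    closed_meetP closed_joinP.

Lemma closed_bot_subproof : set0 \in moore_sets S.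
Proof. by apply: trivial_closed; rewrite !inE eqxx. Qed.

Lemma closed_bot_le x : closed_le (ClosedSet closed_bot_subproof) x.
Proof. by rewrite /closed_le sub0set. Qed.

Lemma closed_le_top x : closed_le x closed_top.
Proof. by rewrite /closed_le subsetT. Qed.

HB.instance Definition _ :=
  Order.hasBottom.Build (Order.Disp tt tt) closed_set closed_bot_le.
HB.instance Definition _ :=
  Order.hasTop.Build (Order.Disp tt tt) closed_set closed_le_top.

Lemma closed_atom_subproof i : [set i] \in moore_sets S.
Proof. by apply: trivial_closed; rewrite !inE imset_f ?orbT. Qed.

Definition closed_atom i : closed_set := ClosedSet (closed_atom_subproof i).

Local Open Scope order_scope.

Lemma closed_leE x y : (x <= y) = (val x \subset val y).
Proof. by []. Qed.

Lemma closed_atom_le i x : (closed_atom i <= x) = (i \in val x).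
Proof. by rewrite closed_leE sub1set. Qed.

Lemma closed_atom_inj : injective closed_atom.
Proof. by move=> i j /(congr1 val)/set1_inj. Qed.

Lemma closed_bot_lt x : (\bot < x) = (val x != set0).
Proof. by rewrite lt0x -(inj_eq val_inj). Qed.

Lemma closed_atomP x : is_atom x <-> exists i, x = closed_atom i.
Proof.
split=> [[]|[i ->]].
  rewrite closed_bot_lt => /set0Pn[i ix] minx; exists i.
  apply/eqP; have := minx (closed_atom i).
  rewrite closed_bot_lt.
  have -> : val (closed_atom i) != set0 by apply/set0Pn; exists i; rewrite inE.
  by rewrite lt_neqAle closed_atom_le ix andbT /= negbK eq_sym.
split; first by rewrite closed_bot_lt; apply/set0Pn; exists i; rewrite inE.
move=> y; rewrite closed_bot_lt; apply/andP => -[/set0Pn[j jy] yi].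
have := yi; rewrite lt_neqAle closed_leE => /andP[ne sub].
have := subsetP sub _ jy; rewrite inE => /eqP eji; rewrite -eji in ne sub.
case/negP: ne; apply/eqP/le_anti; rewrite closed_leE sub /=.
by rewrite closed_atom_le.
Qed.

Lemma closed_atomic : is_atomic closed_set.
Proof.
move=> x _; exists [set closed_atom i | i in val x]; split.
  by move=> _ /imsetP[i _ ->]; apply/closed_atomP; exists i.
apply/le_anti/andP; split; last first.
  by apply/joinsP => _ /imsetP[i ix ->]; rewrite closed_atom_le.
rewrite closed_leE; apply/subsetP => i ix; rewrite -closed_atom_le.
by apply: (joins_min (j := closed_atom i)); first exact: imset_f.
Qed.

Definition realization : atomicLattice n :=
  AtomicLattice closed_atomic closed_atom_inj closed_atomP.

Lemma family_realization : family realization = moore_sets S.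
Proof.
have bE (x : realization) : atoms_below x = val (x : closed_set).
  by apply/setP => i; rewrite atoms_belowP closed_atom_le.
apply/setP => A; apply/imsetP/idP => [[x _ ->]|AS].
  by rewrite bE; apply: valP.
by exists (ClosedSet AS); rewrite ?bE.
Qed.

End Realization.

(** * Isomorphism classes as closure systems *)

Section IsoClasses.
Variable n : nat.
Implicit Types (X Y : calL n).

(** All representatives of a class have the same family, so asking for some
    representative yields that family without choosing one. *)
Definition system X : {set {set 'I_n}} :=
  [set A | `[< exists2 P, sval X P & A \in family P >]].

Lemma systemE X P : sval X P -> system X = family P.
Proof.
move=> XP; apply/setP => A; rewrite inE.
apply/asboolP/idP => [[Q XQ]|AP]; last by exists P.
case: X XP XQ => C [P0 /= CE]; rewrite CE => /al_isoP eP /al_isoP eQ.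
by rewrite -eP eQ.
Qed.

Lemma sval_calL X : exists2 P, sval X P & sval X = al_iso P.
Proof. by case: X => C [P /= CE]; exists P => //; rewrite CE; apply/al_isoP. Qed.

Lemma calL_leP X Y : calL_le X Y <-> system X \subset system Y.
Proof.
split=> [[Q [P [XQ YP /al_leP]]]|sub]; first by rewrite (systemE XQ) (systemE YP).
have [[Q XQ _] [P YP _]] := (sval_calL X, sval_calL Y).
by exists Q, P; split=> //; apply/al_leP; rewrite -(systemE XQ) -(systemE YP).
Qed.

(** Isomorphism classes are predicates with a proof attached, so their equality
    rests on extensionality of predicates and proof irrelevance. *)
Lemma system_inj : injective system.
Proof.
move=> X Y eXY; have [[P XP XE] [Q YQ YE]] := (sval_calL X, sval_calL Y).
have ePQ : sval X = sval Y.
  rewrite XE YE predeqE => R; rewrite !al_isoP.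
  by rewrite -(systemE XP) -(systemE YQ) eXY.
by case: X Y ePQ {eXY XP XE YQ YE} => [C hC] [D hD] /= eCD; apply: eq_exist.
Qed.

Lemma system_closure X : closure_system (system X).
Proof. by have [P /systemE-> _] := sval_calL X; apply: family_closure_system. Qed.

Lemma system_onto S : closure_system S -> exists X, system X = S.
Proof.
move=> clS; pose P := realization (Moore clS).
have exP : exists Q, al_iso P = al_iso Q by exists P.
exists (exist _ (al_iso P) exP).
rewrite (@systemE _ P) ?family_realization //=; exact/al_isoP.
Qed.

Lemma calL_partial_order : is_partial_order (@calL_le n).
Proof.
split=> [X|X Y|X Y Z]; rewrite !calL_leP //.
  by move=> XY YX; apply/system_inj/eqP; rewrite eqEsubset XY.
exact: subset_trans.
Qed.

Lemma calL_lattice : is_lattice (@calL_le n).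
Proof.
split=> [|X Y]; first exact: calL_partial_order.
split.
  have [clM sX sY] := meets_closure_system (system_closure X) (system_closure Y).
  have [Z ZE] := system_onto clM.
  exists Z; split=> [||U]; rewrite !calL_leP ZE // => XU YU.
  apply/subsetP => _ /imset2P[A B AX BY ->]; have [_ iU] := system_closure U.
  by apply: iU; [apply: (subsetP XU)|apply: (subsetP YU)].
have [Z ZE] := system_onto (closure_systemI (system_closure X) (system_closure Y)).
by exists Z; split=> [||U]; rewrite !calL_leP ZE ?subsetIl ?subsetIr // subsetI => -> ->.
Qed.

End IsoClasses.

(* For n >= 2 the subtraction is exact; L(0) and L(1) have one element and
   2 ^ n - n - 2 is truncated to 0. *)
Theorem theorem5p2 (n : nat) :
  is_graded_lattice_of_rank (@calL_le n) (2 ^ n - n - 2).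
Proof.
split=> [|C maxC]; first exact: calL_lattice.
have [B BE] := system_onto (trivial_closure_system n).
have [T TE] := system_onto (full_closure_system n).
have -> : 2 ^ n - n - 2 = #|system T| - #|system B|.
  by rewrite -card_trivial_sets TE BE -powersetT card_powerset cardsT card_ord.
have properE (X Y : calL n) : calL_le X Y -> X <> Y -> system X \proper system Y.
  rewrite calL_leP properEneq => -> neq; rewrite andbT.
  by apply/eqP => /system_inj.
apply: (@maximal_chain_length _ _ (fun X => #|system X|) B T) maxC
  => [|X|X|X Y XY neq|X Y XY neq]; first exact: calL_partial_order.
- by rewrite calL_leP BE; have [] := system_closure X.
- by rewrite calL_leP TE subsetT.
- exact/proper_card/properE.
have [A AY [sXA clA]] :=
  closure_system_remove (system_closure X) (system_closure Y) (properE _ _ XY neq).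
have [Z ZE] := system_onto clA.
exists Z; split; first by rewrite calL_leP ZE.
  by rewrite calL_leP ZE subD1set.
by rewrite ZE (cardsD1 A (system Y)) AY.
Qed.
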